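(* Let $p$ be an odd prime, let $\epsilon>0$, and put $$\Delta=\frac{\epsilon^6}{2^{13}p^2}\exp\!\left(-16\,\epsilon^{-1}c_p\log p\right),$$ where $c_p$ is the constant described in the context. Suppose $f:\mathbb{F}_{p^n}\to[0,1]$ has the property that for every subspace $W$ of $\mathbb{F}_{p^n}$ of codimension at most $\Delta^{-2}$, $$\mathbb{E}(|f(m)-f_W(m)|)>\epsilon.$$ Then there exists a function $g:\mathbb{F}_{p^n}\to[0,1]$ such that $\mathbb{E}(g)=\mathbb{E}(f)$ and $\Lambda_3(g)<\Lambda_3(f)-\Delta$.
   Context: $\mathbb{F}_{p^n}$ is regarded as an $n$-dimensional vector space over $\mathbb{F}_p$; ''subspace'' means $\mathbb{F}_p$-subspace. For $g:\mathbb{F}_{p^n}\to\mathbb{C}$, $\mathbb{E}(g)=p^{-n}\sum_{m} g(m)$. For $f:\mathbb{F}_{p^n}\to[0,1]$, $\Lambda_3(f)=p^{-2n}\sum_{m,d} f(m)f(m+d)f(m+2d)$, and for a subspace $W$, $f_W(m)=|W|^{-1}\sum_{w\in W} f(m+w)$. The constant $c_p>0$ depends only on $p$ and is one for which Meshulam's theorem holds: for every $n$, every $S\subseteq\mathbb{F}_{p^n}$ with $|S|\ge c_p p^n/n$ contains a non-trivial three-term arithmetic progression $a,a+d,a+2d$ with $d\neq0$. *)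

(* Defs.v *)
From HB Require Import structures.
From mathcomp Require Import all_boot all_order all_algebra.
From mathcomp Require Import reals.
From mathcomp.analysis Require Import sequences exp.
Set Implicit Arguments. Unset Strict Implicit. Unset Printing Implicit Defensive.
Import Order.TTheory GRing.Theory Num.Theory.
Local Open Scope ring_scope.

(* F_{p^n}, viewed as an n-dimensional F_p-vector space, is modelled by
   the row vectors 'rV['F_p]_n.  An F_p-subspace W is the row space of a
   square matrix W : 'M['F_p]_n; membership is (v <= W)%MS, dimension \rank W. *)

Section Defs.
Variables (R : realType) (p n : nat).
Notation V := 'rV['F_p]_n.

Definition subsp (W : 'M['F_p]_n) : {set V} := [set v : V | (v <= W)%MS].

Definition codim (W : 'M['F_p]_n) : nat := (n - \rank W)%N.

Definition Ex (g : V -> R) : R := (p%:R ^+ n)^-1 * \sum_(m : V) g m.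

Definition Lambda3 (f : V -> R) : R :=
  (p%:R ^+ n)^-2 * \sum_(m : V) \sum_(d : V) f m * f (m + d) * f (m + d *+ 2).

Definition favg (W : 'M['F_p]_n) (f : V -> R) (m : V) : R :=
  (#|subsp W|%:R)^-1 * \sum_(w in subsp W) f (m + w).

End Defs.

Definition meshulam (R : realType) (p : nat) (c : R) : Prop :=
  forall (k : nat), (0 < k)%N ->
  forall S : {set 'rV['F_p]_k},
    c * (p%:R ^+ k) / k%:R <= #|S|%:R ->
    exists a d : 'rV['F_p]_k,
      [/\ d != 0, a \in S, a + d \in S & a + d *+ 2 \in S].

(* Main.v *)
Require Import Defs.
From HB Require Import structures.
From mathcomp Require Import all_boot all_order all_algebra.
From mathcomp Require Import reals.
From mathcomp.analysis Require Import sequences exp.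
From mathcomp Require Import ring lra zify.
Set Implicit Arguments. Unset Strict Implicit. Unset Printing Implicit Defensive.
Import Order.TTheory GRing.Theory Num.Theory.
Local Open Scope ring_scope.

(* Let W annihilate the large spectrum of f and split f = F + u with F = f_W. Since F
   is constant on cosets of W and u (or any h) sums to zero on them, all mixed terms
   of the trilinear form vanish: T3(F + h) = T3(F) + T3(h). Smallness of the spectrum
   of u makes T3(u) negligible, so it is enough to find h with T3(h) very negative and
   0 <= F + h <= 1. As f is far from F, the W-invariant set T where F (1 - F) >= eps/4
   has density more than eps; Meshulam's theorem and Varnavides' averaging give many
   progressions in T. Take h = -(eps/4) 1_T phi(l), where l is a linear form that is
   not constant on W and phi is a balanced function on F_p with T3(phi) >= p^2/128.

   Instead of complex characters, the spectrum of u at b is measured by the energy of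
   its Radon transform s |-> sum of u over {b.x = s}, for which there are Parseval and
   inversion formulas in real numbers. *)

(** * Three-term progressions in a finite abelian group *)

(** An unnormalised [Lambda3]. The group is arbitrary because the form is needed on [F_p] as well as
    on [F_p^n]; the three arguments make room for mixed terms. *)
Definition T3 (R : pzRingType) (G : finZmodType) (a b c : G -> R) : R :=
  \sum_m \sum_d a m * b (m + d) * c (m + d *+ 2).

Lemma sum_shift (R : pzRingType) (G : finZmodType) (F : G -> R) (w : G) :
  \sum_m F (m + w) = \sum_m F m.
Proof. by rewrite [RHS](reindex_inj (addIr w)). Qed.

Lemma T3_shift (R : pzRingType) (G : finZmodType) (a b c : G -> R) (s e : G) :
  T3 a b c = \sum_m \sum_d
    a (m + s) * b (m + d + (s + e)) * c (m + d *+ 2 + (s + e *+ 2)).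
Proof.
rewrite /T3 -(sum_shift _ s); apply: eq_bigr => m _.
rewrite -(sum_shift _ e); apply: eq_bigr => d _.
by rewrite mulrnDl !(addrACA m s).
Qed.

(** For each [w], replacing [m] by [m + s w] and [d] by [d + e w] permutes the progressions, so [T3]
    equals its average over [w] in [W], and there the inner sums vanish. *)
Lemma T3_avg_eq0 (R : realFieldType) (G : finZmodType) (W : {set G})
  (s e : G -> G) (a b c : G -> R) :
  (0 < #|W|)%N ->
  (forall m d, \sum_(w in W) a (m + s w) * b (m + d + (s w + e w))
      * c (m + d *+ 2 + (s w + e w *+ 2)) = 0) ->
  T3 a b c = 0.
Proof.
move=> W0 H; apply/eqP.
have : #|W|%:R * T3 a b c = 0.
  rewrite mulr_natl -sumr_const.
  under eq_bigr => w _ do rewrite (T3_shift _ _ _ (s w) (e w)).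
  rewrite exchange_big big1 // => m _; rewrite exchange_big big1 // => d _.
by move/eqP; rewrite mulf_eq0 pnatr_eq0 -leqn0 leqNgt W0.
Qed.

(** Each of the six mixed terms vanishes by [T3_avg_eq0]: the shifts are chosen so that exactly one
    factor [u] moves, while a second [u] stays fixed and the factors [F] keep their values. *)
Lemma T3_add (R : realFieldType) (G : finZmodType) (W : {set G})
  (F u g : G -> R) :
  (0 < #|W|)%N ->
  (forall m w, w \in W -> F (m + w) = F m) ->
  (forall m, \sum_(w in W) u (m + w) = 0) ->
  (forall m, \sum_(w in W) u (m + w *+ 2) = 0) ->
  (forall m, g m = F m + u m) ->
  T3 g g g = T3 F F F + T3 u u u.
Proof.
move=> W0 FW uW uW2 gE.
have FN m w : w \in W -> F (m - w) = F m.
  by move=> wW; rewrite -(FW (m - w) w wW) subrK.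
have F2 m w : w \in W -> F (m + w *+ 2) = F m.
  by move=> wW; rewrite mulr2n addrA !FW.
have e1 : T3 F F u = 0.
  apply: (@T3_avg_eq0 _ _ W (fun w => - w) id) => // m d.
  transitivity (F m * F (m + d) * \sum_(w in W) u (m + d *+ 2 + w));
    last by rewrite uW mulr0.
  rewrite mulr_sumr.
  apply: eq_bigr => w wW; rewrite FN // addNr addr0.
  by congr (_ * u (_ + _)); rewrite mulr2n addKr.
have e2 : T3 F u F = 0.
  apply: (@T3_avg_eq0 _ _ W (fun w => 0) id) => // m d.
  transitivity (F m * F (m + d *+ 2) * \sum_(w in W) u (m + d + w));
    last by rewrite uW mulr0.
  rewrite mulr_sumr.
  by apply: eq_bigr => w wW; rewrite addr0 !add0r F2 // mulrAC.
have e3 : T3 u F F = 0.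
  apply: (@T3_avg_eq0 _ _ W id -%R) => // m d.
  transitivity (\sum_(w in W) u (m + w) * (F (m + d) * F (m + d *+ 2)));
    last by rewrite -mulr_suml uW mul0r.
  apply: eq_bigr => w wW; rewrite /= subrr addr0 -mulrA.
  have -> : w + - w *+ 2 = - w by rewrite mulr2n addrA subrr add0r.
  by rewrite FN.
have e4 : T3 F u u = 0.
  apply: (@T3_avg_eq0 _ _ W (fun w => w *+ 2) -%R) => // m d.
  transitivity (F m * u (m + d *+ 2) * \sum_(w in W) u (m + d + w));
    last by rewrite uW mulr0.
  rewrite mulr_sumr.
  apply: eq_bigr => w wW; rewrite F2 //= mulNrn subrr addr0 mulrAC.
  by rewrite [w *+ 2]mulr2n addrK.
(* Both ends carry [u]: with the first one fixed, the other moves by [w *+ 2], which is where the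
   doubled sums enter. *)
have e5 : T3 u F u = 0.
  apply: (@T3_avg_eq0 _ _ W (fun w => 0) id) => // m d.
  transitivity (u m * F (m + d) * \sum_(w in W) u (m + d *+ 2 + w *+ 2));
    last by rewrite uW2 mulr0.
  rewrite mulr_sumr.
  by apply: eq_bigr => w wW; rewrite addr0 !add0r FW.
have e6 : T3 u u F = 0.
  apply: (@T3_avg_eq0 _ _ W (fun w => 0) id) => // m d.
  transitivity (u m * F (m + d *+ 2) * \sum_(w in W) u (m + d + w));
    last by rewrite uW mulr0.
  rewrite mulr_sumr.
  by apply: eq_bigr => w wW; rewrite addr0 !add0r F2 // mulrAC.
suff -> : T3 g g g = T3 F F F + T3 F F u + T3 F u F
    + T3 u F F + T3 F u u + T3 u F u + T3 u u F + T3 u u u.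
  by rewrite e1 e2 e3 e4 e5 e6 !addr0.
rewrite /T3 -!big_split; apply: eq_bigr => m _ /=.
by rewrite -!big_split; apply: eq_bigr => d _ /=; rewrite !gE; ring.
Qed.

(** For odd [p] doubling permutes [W]; its inverse is multiplication by [(p + 1) / 2], written
    [(p./2).+1]. *)
Lemma sum_double (R : realFieldType) (p : nat) (G : finZmodType) (W : {set G})
  (u : G -> R) (m : G) :
  odd p -> (forall x : G, x *+ p = 0) ->
  (forall w n, w \in W -> w *+ n \in W) ->
  \sum_(w in W) u (m + w *+ 2) = \sum_(w in W) u (m + w).
Proof.
move=> op tor WM.
have K (w : G) : w *+ (2 * (p./2).+1) = w.
  have -> : (2 * (p./2).+1 = p + 1)%N.
    by rewrite -{2}(odd_double_half p) op mulnS mul2n addnAC addnC.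
  by rewrite mulrnDr tor add0r.
rewrite [RHS](reindex_onto (fun w => w *+ 2) (fun w => w *+ (p./2).+1)) /=.
  apply: eq_bigl => w; rewrite -mulrnA K eqxx andbT.
  apply/idP/idP => [/WM-> //|/(WM _ (p./2).+1)].
  by rewrite -mulrnA K.
by move=> w _; rewrite -mulrnA mulnC K.
Qed.

Lemma sum_shift_avg (R : pzRingType) (G : finZmodType) (I : finType) (s : I -> G)
  (F : G -> R) :
  #|I|%:R * \sum_m F m = \sum_m \sum_i F (m + s i).
Proof.
rewrite exchange_big [RHS](eq_bigr (fun=> \sum_m F m)) => [|i _]; last exact: sum_shift.
by rewrite sumr_const mulr_natl.
Qed.

(** In this form a progression is a solution of a linear equation, to which linear forms can be
    applied. *)
Lemma T3_triple (R : comPzRingType) (G : finZmodType) (a b c : G -> R) :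
  T3 a b c = \sum_x \sum_y \sum_z (x - y *+ 2 + z == 0)%:R * (a x * b y * c z).
Proof.
apply: eq_bigr => x _; rewrite [RHS](reindex_inj (addrI x)); apply: eq_bigr => d _ /=.
have E z : x - (x + d) *+ 2 + z = z - (x + d *+ 2).
  by rewrite mulrnDl [x *+ 2]mulr2n !opprD -!addrA addNKr [RHS]addrC -!addrA.
rewrite (bigD1 (x + d *+ 2)) //= big1 => [|z zN]; last first.
  by rewrite E subr_eq0 (negPf zN) mul0r.
by rewrite E subrr eqxx mul1r addr0.
Qed.

(** Cauchy-Schwarz, from the nonnegativity of the sum of all [(a i - a j) ^+ 2]. *)
Lemma sqr_sum_le (R : realFieldType) (I : finType) (a : I -> R) :
  (\sum_i a i) ^+ 2 <= #|I|%:R * \sum_i a i ^+ 2.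
Proof.
have : 0 <= \sum_i \sum_j (a i - a j) ^+ 2.
  by apply: sumr_ge0 => i _; apply: sumr_ge0 => j _; apply: sqr_ge0.
have -> : \sum_i \sum_j (a i - a j) ^+ 2
    = (#|I|%:R * \sum_i a i ^+ 2 - (\sum_i a i) ^+ 2) *+ 2.
  have -> : (#|I|%:R * \sum_i a i ^+ 2 - (\sum_i a i) ^+ 2) *+ 2 =
    \sum_i \sum_(j : I) a i ^+ 2 + \sum_(i : I) \sum_j a j ^+ 2
      - 2 * \sum_i \sum_j a i * a j.
    under [in RHS]eq_bigr => i _ do rewrite sumr_const.
    rewrite [X in _ = _ + X - _]sumr_const sumrMnl.
    under [X in _ = _ - _ * X]eq_bigr => i _ do rewrite -mulr_sumr.
    by rewrite -mulr_suml -mulr_natl; ring.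
  rewrite mulr_sumr -big_split -sumrB /=; apply: eq_bigr => i _.
  rewrite mulr_sumr -big_split -sumrB /=; apply: eq_bigr => j _; ring.
by rewrite pmulrn_lge0 // subr_ge0.
Qed.

(** For fixed [m], the product of the last two factors is at most the mean of their squares; as [d]
    varies each argument runs over the whole group, the last because doubling is injective. *)
Lemma norm_T3_le (R : realFieldType) (G : finZmodType) (u : G -> R) :
  injective (fun x : G => x *+ 2) ->
  `|T3 u u u| <= (\sum_m `|u m|) * \sum_m u m ^+ 2.
Proof.
move=> inj2; rewrite mulr_suml; apply: le_trans (ler_norm_sum _ _ _) _.
apply: ler_sum => m _.
under eq_bigr => d _ do rewrite -mulrA.
rewrite -mulr_sumr normrM ler_wpM2l //.
apply: le_trans (ler_norm_sum _ _ _) _.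
apply: (@le_trans _ _ (\sum_d (u (m + d) ^+ 2 / 2 + u (m + d *+ 2) ^+ 2 / 2))).
  apply: ler_sum => d _; rewrite -mulrDl ler_pdivlMr // mulr_natr normrM.
  rewrite -[u (m + d) ^+ 2]real_normK ?num_real //.
  rewrite -[u (m + d *+ 2) ^+ 2]real_normK ?num_real //.
  set x := `|_|; set y := `|_|; have := sqr_ge0 (x - y).
  by rewrite sqrrB -subr_ge0; lra.
rewrite big_split /= -!mulr_suml.
have -> : \sum_i u (m + i) ^+ 2 = \sum_m u m ^+ 2.
  by rewrite [RHS](reindex_inj (addrI m)).
have -> : \sum_i u (m + i *+ 2) ^+ 2 = \sum_m u m ^+ 2.
  by rewrite [RHS](reindex_inj (inj_comp (addrI m) inj2)).
by rewrite -splitr.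
Qed.

(** * Linear forms and the Radon transform *)

Definition dot (F : fieldType) (n : nat) (b x : 'rV[F]_n) : F := (x *m b^T) 0 0.

Lemma dotC (F : fieldType) n (b x : 'rV[F]_n) : dot b x = dot x b.
Proof. by rewrite /dot -[in LHS](trmxK x) -trmx_mul mxE. Qed.

Lemma dotDr (F : fieldType) n (b x y : 'rV[F]_n) : dot b (x + y) = dot b x + dot b y.
Proof. by rewrite /dot mulmxDl mxE. Qed.

Lemma dotZr (F : fieldType) n (b x : 'rV[F]_n) a : dot b (a *: x) = a * dot b x.
Proof. by rewrite /dot -scalemxAl mxE. Qed.

Lemma dot0r (F : fieldType) n (b : 'rV[F]_n) : dot b 0 = 0.
Proof. by rewrite /dot mul0mx mxE. Qed.

Lemma dotNr (F : fieldType) n (b x : 'rV[F]_n) : dot b (- x) = - dot b x.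
Proof. by rewrite -scaleN1r dotZr mulN1r. Qed.

Lemma dotMnr (F : fieldType) n (b x : 'rV[F]_n) k : dot b (x *+ k) = dot b x *+ k.
Proof. by rewrite -scaler_nat dotZr mulr_natl. Qed.

Lemma dot_eq1 (F : fieldType) n (z : 'rV[F]_n) : z != 0 -> exists e, dot z e = 1.
Proof.
case/rV0Pn => i zi; exists ((z 0 i)^-1 *: delta_mx 0 i).
by rewrite dotZr /dot -rowE !mxE mulVf.
Qed.

(* The real function t |-> q [t = 0] - 1 is the sum of the nontrivial additive
   characters of F, so this is the orthogonality relation of characters, without
   complex numbers. *)
Lemma dot_orthogonality (R : realFieldType) (F : finFieldType) n (z : 'rV[F]_n) :
  \sum_b (#|F|%:R * (dot b z == 0)%:R - 1) =
  (#|F|%:R - 1) * #|F|%:R ^+ n * (z == 0)%:R :> R.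
Proof.
have q0 : #|F|%:R != 0 :> R by rewrite pnatr_eq0 -lt0n; apply/card_gt0P; exists 0.
case: (eqVneq z 0) => [->|/dot_eq1[e ze]] /=.
  under eq_bigr => b _ do rewrite dot0r eqxx mulr1.
  by rewrite sumr_const -[LHS]mulr_natr card_mx mul1n natrX mulr1.
rewrite mulr0; apply: (mulfI q0); rewrite mulr0.
rewrite (sum_shift_avg (fun t : F => t *: e)) big1 // => b _.
under eq_bigr => t _ do rewrite dotC dotDr dotZr ze mulr1.
rewrite sumrB sumr_const -mulr_sumr (bigD1 (- dot z b)) //= subrr eqxx.
rewrite big1 ?addr0 ?mulr1 ?subrr // => t tN.
by rewrite addrC addr_eq0 (negPf tN).
Qed.

(** The push-forward of [u] along [dot b]; it carries the same information as the Fourier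
    coefficients of [u] at the multiples of [b]. *)
Definition radon (R : realFieldType) (F : finFieldType) n (u : 'rV[F]_n -> R)
  (b : 'rV[F]_n) (s : F) : R := \sum_(x | dot b x == s) u x.

(** By Parseval on [F], [#|F|] times this is the sum of the squared moduli of the unnormalised
    Fourier coefficients at [c *: b], for [c] in [F]. *)
Definition radon_energy (R : realFieldType) (F : finFieldType) n (u : 'rV[F]_n -> R)
  (b : 'rV[F]_n) : R := \sum_s radon u b s ^+ 2.

Lemma sum_radon (R : realFieldType) (F : finFieldType) n (u : 'rV[F]_n -> R) b
  (H : F -> R) :
  \sum_s H s * radon u b s = \sum_x H (dot b x) * u x.
Proof.
rewrite [RHS](partition_big (dot b) xpredT) //=; apply: eq_bigr => s _.
by rewrite mulr_sumr; apply: eq_bigr => x /eqP->.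
Qed.

Lemma radon_energyE (R : realFieldType) (F : finFieldType) n (u : 'rV[F]_n -> R) b :
  radon_energy u b = \sum_x \sum_y (dot b (x - y) == 0)%:R * (u x * u y).
Proof.
rewrite /radon_energy; under eq_bigr => s _ do rewrite expr2.
rewrite sum_radon; apply: eq_bigr => x _; rewrite mulr_suml big_mkcond /=.
apply: eq_bigr => y _; rewrite dotDr dotNr subr_eq0 eq_sym.
by case: eqP; rewrite ?mul1r ?mul0r // mulrC.
Qed.

Lemma T3_radon (R : realFieldType) (F : finFieldType) n (u : 'rV[F]_n -> R) b :
  T3 (radon u b) (radon u b) (radon u b) =
  \sum_x \sum_y \sum_z (dot b (x - y *+ 2 + z) == 0)%:R * (u x * u y * u z).
Proof.
rewrite T3_triple.
transitivity (\sum_s (\sum_t (\sum_r (s - t *+ 2 + r == 0)%:R * radon u b r)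
   * radon u b t) * radon u b s).
  move: (radon u b) => v; apply: eq_bigr => s _.
  rewrite mulr_suml; apply: eq_bigr => t _.
  by rewrite !mulr_suml; apply: eq_bigr => r _; ring.
rewrite sum_radon; apply: eq_bigr => x _.
rewrite sum_radon mulr_suml; apply: eq_bigr => y _.
rewrite sum_radon !mulr_suml; apply: eq_bigr => z _.
by rewrite !dotDr dotNr dotMnr; ring.
Qed.

Lemma radon_energy_ge0 (R : realFieldType) (F : finFieldType) n (u : 'rV[F]_n -> R) b :
  0 <= radon_energy u b.
Proof. by apply: sumr_ge0 => s _; apply: sqr_ge0. Qed.

(** Expanding the energies gives the weights [dot b (x - y) == 0]. As [u] has sum zero, a constant
    may be subtracted from them, and [dot_orthogonality] then leaves only [x = y]. *)
Lemma radon_parseval (R : realFieldType) (F : finFieldType) n (u : 'rV[F]_n -> R) :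
  \sum_x u x = 0 ->
  #|F|%:R * \sum_b radon_energy u b =
  (#|F|%:R - 1) * #|F|%:R ^+ n * \sum_x u x ^+ 2.
Proof.
move=> u0; under eq_bigr => b _ do rewrite radon_energyE.
rewrite exchange_big !mulr_sumr /=; apply: eq_bigr => x _; rewrite exchange_big /=.
transitivity (\sum_y (\sum_b (#|F|%:R * (dot b (x - y) == 0)%:R - 1)) * (u x * u y)).
  rewrite mulr_sumr; apply/eqP; rewrite -subr_eq0 -sumrB.
  transitivity (\sum_y #|{: 'rV[F]_n}|%:R * (u x * u y) == 0); last first.
    by rewrite -mulr_sumr -mulr_sumr u0 !mulr0 eqxx.
  congr (_ == _); apply: eq_bigr => y _.
  by rewrite sumrB sumr_const -mulr_sumr -mulr_suml; ring.
under eq_bigr => y _ do rewrite dot_orthogonality subr_eq0.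
rewrite (bigD1 x) //= big1 => [|y yx]; first by rewrite eqxx mulr1 addr0 expr2.
by rewrite eq_sym (negPf yx) mulr0 mul0r.
Qed.

(** The argument of [radon_parseval] with the weights of [T3_radon]: the subtracted constant is
    killed by the sum over [z], and only progressions survive. *)
Lemma T3_inversion (R : realFieldType) (F : finFieldType) n (u : 'rV[F]_n -> R) :
  \sum_x u x = 0 ->
  #|F|%:R * \sum_b T3 (radon u b) (radon u b) (radon u b) =
  (#|F|%:R - 1) * #|F|%:R ^+ n * T3 u u u.
Proof.
move=> u0; rewrite T3_triple.
under eq_bigr => b _ do rewrite T3_radon.
rewrite exchange_big !mulr_sumr /=; apply: eq_bigr => x _.
rewrite exchange_big !mulr_sumr /=; apply: eq_bigr => y _.
rewrite exchange_big !mulr_sumr /=.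
apply/eqP; rewrite -subr_eq0 -sumrB.
transitivity (\sum_z #|{: 'rV[F]_n}|%:R * (u x * u y * u z) == 0); last first.
  by rewrite -mulr_sumr -mulr_sumr u0 !mulr0 eqxx.
congr (_ == _); apply: eq_bigr => z _.
rewrite [X in _ - X]mulrA -dot_orthogonality sumrB sumr_const -mulr_sumr -mulr_suml.
by ring.
Qed.

(** [T3_inversion] reduces to Radon transforms on [F]; [norm_T3_le] bounds each by its l1 norm, at
    most [D] by Cauchy-Schwarz, times its energy, and [radon_parseval] adds up the energies. *)
Lemma norm_T3_le_energy (R : realFieldType) (F : finFieldType) n
  (u : 'rV[F]_n -> R) (D : R) :
  injective (fun x : F => x *+ 2) ->
  \sum_x u x = 0 -> 0 <= D ->
  (forall b, #|F|%:R * radon_energy u b <= D ^+ 2) ->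
  `|T3 u u u| <= D * \sum_x u x ^+ 2.
Proof.
move=> inj2 u0 D0 uD.
have q1 : 1 < #|F|%:R :> R by rewrite ltr1n card_finNzRing_gt1.
have c0 : 0 < (#|F|%:R - 1) * #|F|%:R ^+ n :> R.
  by rewrite mulr_gt0 ?subr_gt0 // exprn_gt0 // (lt_trans ltr01).
rewrite -(ler_pM2l c0) -{1}(gtr0_norm c0) -normrM -T3_inversion //.
rewrite mulrCA -radon_parseval // mulrCA normrM ger0_norm ?ler0n //.
rewrite ler_wpM2l // mulr_sumr; apply: le_trans (ler_norm_sum _ _ _) _.
apply: ler_sum => b _; apply: le_trans (norm_T3_le _ inj2) _.
rewrite ler_wpM2r ?radon_energy_ge0 //.
rewrite -(@ler_pXn2r _ 2) ?nnegrE ?sumr_ge0 //.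
apply: le_trans (sqr_sum_le _) (le_trans _ (uD b)).
by rewrite ler_wpM2l // ler_sum // => s _; rewrite real_normK ?num_real.
Qed.

(** * A balanced function on [F_p] with many progressions *)

Lemma Fp_double_inj (p : nat) : prime p -> odd p -> injective (fun x : 'F_p => x *+ 2).
Proof.
move=> pp op x y /eqP; rewrite -subr_eq0 -mulrnBl -mulr_natr mulf_eq0 subr_eq0.
case/orP => [/eqP//|]; rewrite -(dvdn_pcharf (pchar_Fp pp)) dvdn_prime2 //.
by move/eqP => p2; rewrite p2 in op.
Qed.

Lemma sum_Fp_lt (R : pzRingType) (p q : nat) : prime p -> (q <= p)%N ->
  \sum_(x : 'F_p) (x < q)%N%:R = q%:R :> R.
Proof.
move=> pp qp; rewrite -natr_sum -big_mkcond /= sum1_card.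
have qN : (q <= (Zp_trunc (pdiv p)).+2)%N by rewrite Fp_cast.
by rewrite -sum1_card (big_ord_narrow qN) sum1_card card_ord.
Qed.

(* Two elements of [0, q) of the same parity have their midpoint in [0, q). *)
Lemma T3_interval_ge (R : realFieldType) (p q : nat) (a : 'F_p -> R) :
  prime p -> odd p -> (q <= p)%N -> (forall x, a x = (x < q)%N%:R) ->
  q%:R ^+ 2 / 2 <= T3 a a a.
Proof.
move=> pp op qp aE.
have two0 : (2 : 'F_p) != 0.
  rewrite -(dvdn_pcharf (pchar_Fp pp)) dvdn_prime2 //.
  by apply/eqP => p2; rewrite p2 in op.
have midE (m z : 'F_p) : m + ((z - m) / 2) *+ 2 = z.
  by rewrite -mulr_natr divfK // addrC subrK.
pose N b := \sum_x a x * (odd (x : 'F_p) == b)%:R.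
have NN : N true + N false = q%:R.
  rewrite -(sum_Fp_lt R pp qp) -big_split; apply: eq_bigr => x _ /=.
  by rewrite -mulrDr aE; case: (odd _); rewrite ?addr0 ?add0r mulr1.
apply: (@le_trans _ _ (N true ^+ 2 + N false ^+ 2)).
  by rewrite -NN; have := sqr_ge0 (N true - N false); nra.
have -> : N true ^+ 2 + N false ^+ 2
    = \sum_x \sum_z a x * a z * (odd (x : 'F_p) == odd (z : 'F_p))%:R.
  rewrite !expr2 !mulr_suml -big_split; apply: eq_bigr => x _ /=.
  rewrite !mulr_sumr -big_split; apply: eq_bigr => z _ /=.
  by case: (odd x); case: (odd z) => /=; ring.
apply: ler_sum => x _.
(* For fixed [x] the difference is reparametrised by the end point [z], which makes the middle term
   the midpoint of [x] and [z]. *)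
have inj : injective (fun z : 'F_p => (z - x) / 2).
  by move=> y z e; rewrite -(midE x y) e midE.
rewrite [leRHS](reindex_inj inj); apply: ler_sum => z _ /=.
rewrite midE !aE; case: (ltnP x q) => xq; last by rewrite !mul0r.
case: (ltnP z q) => zq; last by rewrite !(mulr0, mul0r).
rewrite !mul1r mulr1; case: eqP => // oxz.
suff -> : x + (z - x) / 2 = ((x + z)./2)%:R.
  rewrite val_Fp_nat // modn_small; last by lia.
  by have -> : ((x + z)./2 < q)%N by lia.
apply: (mulIf two0); rewrite mulrDl divfK // -natrM.
have -> : ((x + z)./2 * 2 = x + z)%N by lia.
by rewrite natrD !natr_Zp; ring.
Qed.

(** The witness is the indicator of [[0, q)] minus its density [al]. [T3_add], with all of [F_p] as
    [W], subtracts exactly [al^3 p^2], so at least [p^2 al^2 (1/2 - al)] remains. *)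
Lemma exists_balanced_T3_ge (R : realFieldType) (p : nat) : prime p -> odd p ->
  exists phi : 'F_p -> R, [/\ forall x, `|phi x| <= 1,
    \sum_x phi x = 0 & p%:R ^+ 2 / 128 <= T3 phi phi phi].
Proof.
(* [q] is [p / 3] rounded up; [q / p] lies between [1/3] and [3/7], the latter attained at
   [p = 7]. *)
move=> pp op; pose q := ((p + 2) %/ 3)%N.
have p2 := prime_gt1 pp.
have q1 : (p <= 3 * q)%N by rewrite /q; lia.
have q2 : (7 * q <= 3 * p)%N by rewrite /q; lia.
have qp : (q <= p)%N by lia.
have p0 : 0 < p%:R :> R by rewrite ltr0n; lia.
have [q1' q2'] : p%:R <= 3 * q%:R :> R /\ 7 * q%:R <= 3 * p%:R :> R.
  by rewrite -!natrM !ler_nat.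
pose al : R := q%:R / p%:R.
have alp : al * p%:R = q%:R by rewrite divfK ?gt_eqF.
pose phi (x : 'F_p) : R := (x < q)%N%:R - al.
have s0 : \sum_x phi x = 0.
  by rewrite sumrB sum_Fp_lt // sumr_const card_Fp // -[X in _ - X]mulr_natr alp subrr.
exists phi; split => //.
  move=> x; rewrite /phi; have : 0 <= al <= 1.
    by rewrite -(ler_pM2r p0) -[_ <= 1](ler_pM2r p0); lra.
  by case: (_ < _)%N => /=; rewrite ler_norml; lra.
pose al0 (x : 'F_p) := al.
pose a (x : 'F_p) : R := (x < q)%N%:R.
have : T3 a a a = T3 al0 al0 al0 + T3 phi phi phi.
  have sh m : \sum_(w in [set: 'F_p]) phi (m + w) = 0.
    rewrite (eq_bigl xpredT) => [|w]; last by rewrite inE.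
    by rewrite -[RHS]s0 [RHS](reindex_inj (addrI m)).
  apply: (@T3_add _ _ [set: 'F_p] al0 phi a) => // [|m|x];
    last by rewrite /a /phi addrC subrK.
    by rewrite cardsT card_Fp // ltnW.
  rewrite (sum_double _ _ op) // => [x|w n _]; last by rewrite inE.
  by rewrite -mulr_natr pchar_Fp_0 // mulr0.
have -> : T3 al0 al0 al0 = al * q%:R ^+ 2.
  rewrite /T3 /al0; under eq_bigr => x _ do rewrite sumr_const.
  by rewrite sumr_const card_Fp // -mulrnA -[LHS]mulr_natr natrM -alp; ring.
have := T3_interval_ge pp op qp (fun x => erefl (a x)).
rewrite -alp.
have al2 : al * 14 <= 6 by rewrite -(ler_pM2r p0); lra.
have al1 : 1 <= al * 3 by rewrite -(ler_pM2r p0); lra.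
move: (T3 a a a) (T3 _ _ _) => A P h E; rewrite {}E in h.
have al4 : 1 / 9 <= al ^+ 2.
  rewrite (_ : 1 / 9 = (1 / 3) ^+ 2); last by field.
  by rewrite ler_pXn2r ?nnegrE //; lra.
(* The bounds on [al] give [1/9 * (1/2 - 3/7) = 1/126], rounded down to [1/128]. *)
have al3 : 1 / 128 <= al ^+ 2 * (1 / 2 - al).
  apply: (@le_trans _ _ (1 / 9 * (1 / 14))); first by lra.
  by rewrite ler_pM //; lra.
have := ler_wpM2l (sqr_ge0 p%:R) al3.
by move: h; rewrite !exprMn; lra.
Qed.

(** * Varnavides' averaging *)

(** If [dot d e = 1], adding [e^T *m z] to [L] shifts [d *m L] by [z]; hence [d *m L] is
    equidistributed for uniform [L]. *)
Lemma sum_mulmx_row (R : pzRingType) (F : finFieldType) (k n : nat) (d : 'rV[F]_k)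
  (H : 'rV[F]_n -> R) :
  d != 0 ->
  #|{: 'rV[F]_n}|%:R * \sum_(L : 'M_(k, n)) H (d *m L) =
  #|{: 'M[F]_(k, n)}|%:R * \sum_z H z.
Proof.
move=> /dot_eq1[e de].
rewrite (sum_shift_avg (fun z : 'rV[F]_n => e^T *m z)) mulr_natl -sumr_const.
apply: eq_bigr => L _; rewrite [RHS](reindex_inj (addrI (d *m L))) /=.
apply: eq_bigr => z _; rewrite mulmxDr mulmxA [d *m e^T]mx11_scalar.
by have := de; rewrite dotC /dot => ->; rewrite mul1mx.
Qed.

(* Varnavides' averaging: restrict the set to the images of F_p^k under all affine
   maps, injective or not. *)
Lemma meshulam_T3_ge (R : realType) (p : nat) (c : R) (n k : nat)
  (T : {set 'rV['F_p]_n}) (t : 'rV['F_p]_n -> R) :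
  prime p -> 0 < c -> meshulam p c -> (0 < k)%N ->
  (forall x, t x = (x \in T)%:R) ->
  p%:R ^+ n * (\sum_x t x - c / k%:R * p%:R ^+ n) <= p%:R ^+ (2 * k) * T3 t t t.
Proof.
move=> pp c0 mesh k0 tE.
have card_rV m : #|{: 'rV['F_p]_m}|%:R = p%:R ^+ m :> R.
  by rewrite card_mx mul1n card_Fp // natrX.
have p0 : 0 < p%:R :> R by rewrite ltr0n prime_gt0.
have pk m : 0 < p%:R ^+ m :> R by rewrite exprn_gt0.
have k0' : 0 < k%:R :> R by rewrite ltr0n.
have t0 x : 0 <= t x by rewrite tE ler0n.
set M : R := #|{: 'M['F_p]_(k, n)}|%:R.
have M0 : 0 < M.
  by rewrite ltr0n; apply/card_gt0P; exists 0.
pose ap x0 (L : 'M['F_p]_(k, n)) (a d : 'rV['F_p]_k) :=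
  t (x0 + a *m L) * t (x0 + (a + d) *m L) * t (x0 + (a + d *+ 2) *m L).
have ap0 x0 L a d : 0 <= ap x0 L a d by rewrite !mulr_ge0.
(* One affine map: if the preimage [S] of [T] is dense, Meshulam's progression contributes 1 on the
   right and the left side is at most [p ^ k]; otherwise the left side is not positive. *)
have key x0 L : \sum_v t (x0 + v *m L) - c / k%:R * p%:R ^+ k
   <= p%:R ^+ k * \sum_a \sum_(d | d != 0) ap x0 L a d.
  pose S := [set v | x0 + v *m L \in T].
  have -> : \sum_v t (x0 + v *m L) = #|S|%:R.
    rewrite -sum1_card natr_sum [RHS]big_mkcond /=; apply: eq_bigr => v _.
    by rewrite tE inE; case: (_ \in _).
  have [le|lt] := leP (c * p%:R ^+ k / k%:R) #|S|%:R.
    have [a [d [d0]]] := mesh k k0 S le; rewrite !inE => aS adS adS2.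
    apply: (@le_trans _ _ (p%:R ^+ k * 1)).
      have : #|S|%:R <= p%:R ^+ k :> R by rewrite -card_rV ler_nat max_card.
      have := divr_gt0 c0 k0'; have := pk k; rewrite mulr1; nra.
    rewrite ler_pM2l // (bigD1 a) //= (bigD1 d) //= -addrA.
    have -> : ap x0 L a d = 1 by rewrite /ap !tE aS adS adS2 !mul1r.
    by rewrite lerDl addr_ge0 ?sumr_ge0 // => i _; apply: sumr_ge0.
  apply: (@le_trans _ _ 0); first by rewrite subr_le0 mulrAC ltW.
  by rewrite mulr_ge0 ?sumr_ge0 // ?ltW // => i _; apply: sumr_ge0.
(* Over all affine maps, the image of a progression with [d != 0] is a uniformly distributed
   progression, possibly degenerate. *)
have apE a d : d != 0 -> p%:R ^+ n * \sum_x0 \sum_L ap x0 L a d = M * T3 t t t.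
  move=> d0; rewrite exchange_big /=.
  have -> : \sum_L \sum_x0 ap x0 L a d
      = \sum_x0 \sum_L t x0 * t (x0 + d *m L) * t (x0 + (d *m L) *+ 2).
    rewrite [RHS]exchange_big /=; apply: eq_bigr => L _.
    rewrite [RHS](reindex_inj (addIr (a *m L))); apply: eq_bigr => x _ /=.
    by rewrite /ap !mulr2n !mulmxDl !addrA.
  rewrite !mulr_sumr; apply: eq_bigr => x _.
  by rewrite -card_rV (sum_mulmx_row (fun z => t x * t (x + z) * t (x + z *+ 2)) d0).
have T0 : 0 <= T3 t t t.
  by rewrite sumr_ge0 // => x _; rewrite sumr_ge0 // => d _; rewrite !mulr_ge0.
have : \sum_x0 \sum_L (\sum_(v : 'rV_k) t (x0 + v *m L) - c / k%:R * p%:R ^+ k)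
    <= \sum_x0 \sum_L (p%:R ^+ k * \sum_a \sum_(d | d != 0) ap x0 L a d).
  by apply: ler_sum => x _; apply: ler_sum => L _; apply: key.
have -> : \sum_x0 \sum_L (\sum_(v : 'rV_k) t (x0 + v *m L) - c / k%:R * p%:R ^+ k)
    = M * p%:R ^+ k * (\sum_x t x - c / k%:R * p%:R ^+ n).
  rewrite exchange_big /=.
  under eq_bigr => L _ do rewrite sumrB sumr_const exchange_big /=.
  under eq_bigr => L _ do under eq_bigr => v _ do rewrite sum_shift.
  by rewrite !sumr_const -[LHS]mulr_natr -[(\sum_x t x) *+ _]mulr_natr
    -[(c / _ * _) *+ _]mulr_natr !card_rV -/M; ring.
have -> : \sum_x0 \sum_L (p%:R ^+ k * \sum_a \sum_(d | d != 0) ap x0 L a d)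
   = p%:R ^+ k * \sum_a \sum_(d | d != 0) \sum_x0 \sum_L ap x0 L a d.
  rewrite mulr_sumr; under eq_bigr => x _ do rewrite -mulr_sumr.
  rewrite -mulr_sumr -mulr_sumr; congr (_ * _).
  under eq_bigr => x _ do rewrite exchange_big /=.
  rewrite exchange_big /=; apply: eq_bigr => a _.
  under eq_bigr => x _ do rewrite exchange_big /=.
  by rewrite exchange_big.
move=> le.
have := ler_wpM2l (ltW (pk n)) le.
rewrite [X in _ <= X]mulrCA mulr_sumr.
under [X in _ <= _ * X]eq_bigr => a _ do rewrite mulr_sumr (eq_bigr _ (apE a)).
have -> : \sum_(a : 'rV['F_p]_k) \sum_(d : 'rV['F_p]_k | d != 0) M * T3 t t t
  = p%:R ^+ k * (#|[pred d : 'rV['F_p]_k | d != 0]|%:R * (M * T3 t t t)).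
  by rewrite !sumr_const -[LHS]mulr_natr card_rV mulrC mulr_natl.
move=> le2.
have : M * p%:R ^+ k * (p%:R ^+ n * (\sum_x t x - c / k%:R * p%:R ^+ n))
   <= M * p%:R ^+ k * (p%:R ^+ (2 * k) * T3 t t t).
  rewrite [leLHS]mulrCA; apply: le_trans le2 _.
  rewrite mul2n -addnn exprD.
  (* Bounding the number of nonzero [d] by [p ^ k], next to [p ^ k] choices of [a], gives the factor
     [p ^ (2 k)]. *)
  have : #|[pred d : 'rV['F_p]_k | d != 0]|%:R <= p%:R ^+ k :> R.
    by rewrite -card_rV ler_nat max_card.
  move: (#|_|%:R) => N Nle.
  have : N * (M * T3 t t t) <= p%:R ^+ k * (M * T3 t t t).
    by rewrite ler_wpM2r // mulr_ge0 // ltW.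
  have := pk k; move: (p%:R ^+ k) => P P0 h.
  have := ler_wpM2l (mulr_ge0 (ltW P0) (ltW P0)) h.
  by set A := T3 _ _ _; nra.
by rewrite ler_pM2l // mulr_gt0.
Qed.

(** * Averages over a subspace and the choice of [W] *)

Lemma norm_sub_le1 (R : realFieldType) (x y : R) :
  0 <= x <= 1 -> 0 <= y <= 1 -> `|x - y| <= 1.
Proof. by rewrite ler_norml; lra. Qed.

(* A family closed under nonzero scalings contains q - 1 multiples of each vector of a
   basis of its span. *)
Lemma exists_annihilator (F : finFieldType) (n : nat) (A : {set 'rV[F]_n}) :
  (forall c b, c != 0 -> b \in A -> c *: b \in A) ->
  exists W : 'M[F]_n,
    (forall b w, b \in A -> (w <= W)%MS -> dot b w = 0) /\
    ((n - \rank W) * #|F|.-1 <= #|A|)%N.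
Proof.
move=> AZ; pose M := \matrix_(i < #|A|) enum_val i : 'M[F]_(#|A|, n).
(* [W] annihilates the rows of [M], which list [A], so its codimension is the rank of [M]. *)
exists (kermx M^T); split => [b w bA /sub_kermxP wM|].
  have := congr1 (fun v : 'rV_ _ => v 0 (enum_rank_in bA b)) wM.
  rewrite mxE [in RHS]mxE /dot => <-; rewrite mxE; apply: eq_bigr => j _.
  by rewrite !mxE enum_rankK_in.
rewrite mxrank_ker mxrank_tr subKn ?rank_leq_col //.
pose B := rowsub (maxrankfun M) M.
pose m (x : 'I_(\rank M) * F) := x.2 *: row x.1 B.
have rB i : row i B \in A by rewrite row_rowsub rowK; apply: enum_valP.
have m_inj : {in setX [set: 'I_(\rank M)] [set~ 0] &, injective m}.
  move=> [i c] [j d]; rewrite !inE /= => c0 d0.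
  rewrite /m /= !rowE !scalemxAl => /(row_free_inj (maxrowsub_free M)) e.
  have := congr1 (fun v : 'rV_ _ => v 0 i) e; rewrite !mxE !eqxx mulr1.
  case: eqP => [-> ->|_ ce]; first by rewrite mulr1.
  by rewrite ce mulr0 eqxx in c0.
have <- : #|setX [set: 'I_(\rank M)] [set~ (0 : F)]| = (\rank M * #|F|.-1)%N.
  by rewrite cardsX cardsT card_ord cardsC1.
rewrite -(card_in_imset m_inj); apply/subset_leq_card/subsetP => z /imsetP[[i c]].
by rewrite !inE /= => c0 ->; apply: AZ.
Qed.

(** Proportional forms have the same kernel. This gives the large spectrum the closure under scaling
    that [exists_annihilator] asks for. *)
Lemma radon_energyZ (R : realFieldType) (F : finFieldType) n (u : 'rV[F]_n -> R) b c :
  c != 0 -> radon_energy u (c *: b) = radon_energy u b.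
Proof.
move=> c0; rewrite !radon_energyE; apply: eq_bigr => x _; apply: eq_bigr => y _.
by rewrite dotC dotZr mulf_eq0 (negPf c0) dotC.
Qed.

Lemma subsp_shift (R : realFieldType) (p n : nat) (W : 'M['F_p]_n)
  (G : 'rV['F_p]_n -> R) v :
  v \in subsp W -> \sum_(w in subsp W) G (w + v) = \sum_(w in subsp W) G w.
Proof.
rewrite inE => vW; rewrite [RHS](reindex_inj (addIr v)) /=.
apply: eq_bigl => w; rewrite !inE; apply/idP/idP => [wW|].
  exact: addmx_sub.
by move=> h; rewrite -(addrK v w) addmx_sub // -scaleN1r scalemx_sub.
Qed.

Lemma subsp_scale (p n : nat) (W : 'M['F_p]_n) a v :
  v \in subsp W -> a *: v \in subsp W.
Proof. by rewrite !inE; apply: scalemx_sub. Qed.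

Lemma card_subsp_gt0 (p n : nat) (W : 'M['F_p]_n) : (0 < #|subsp W|)%N.
Proof. by apply/card_gt0P; exists 0; rewrite inE sub0mx. Qed.

Lemma card_subsp_neq0 (R : realFieldType) (p n : nat) (W : 'M['F_p]_n) :
  #|subsp W|%:R != 0 :> R.
Proof. by rewrite pnatr_eq0 -lt0n card_subsp_gt0. Qed.

Lemma favg_inv (R : realType) (p n : nat) (W : 'M['F_p]_n) (f : 'rV['F_p]_n -> R) m w :
  w \in subsp W -> favg W f (m + w) = favg W f m.
Proof.
move=> wW; rewrite /favg; congr (_ * _).
rewrite -[RHS](subsp_shift (fun v => f (m + v)) wW); apply: eq_bigr => v _.
by rewrite -addrA [w + v]addrC.
Qed.

Lemma favg_sum (R : realType) (p n : nat) (W : 'M['F_p]_n) (f : 'rV['F_p]_n -> R) m :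
  \sum_(w in subsp W) (f (m + w) - favg W f (m + w)) = 0.
Proof.
apply/eqP; rewrite sumrB subr_eq0; apply/eqP.
rewrite [RHS](eq_bigr (fun=> favg W f m)) => [|w wW]; last exact: favg_inv.
by rewrite sumr_const -[RHS]mulr_natl /favg mulVKf ?card_subsp_neq0.
Qed.

Lemma favg_itv (R : realType) (p n : nat) (W : 'M['F_p]_n) (f : 'rV['F_p]_n -> R) m :
  (forall m, 0 <= f m <= 1) -> 0 <= favg W f m <= 1.
Proof.
move=> f01; have W0 : 0 < #|subsp W|%:R :> R by rewrite ltr0n card_subsp_gt0.
have S0 : 0 <= \sum_(w in subsp W) f (m + w).
  by apply: sumr_ge0 => w _; have /andP[] := f01 (m + w).
rewrite /favg mulrC divr_ge0 ?(ltW W0) //=.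
rewrite ler_pdivrMr // mul1r -sumr_const ler_sum // => w _.
by have /andP[] := f01 (m + w).
Qed.

(** Averaging over translations by [W] takes [G] out of the coset sums of [u]. In particular
    [favg W f] is orthogonal to [f - favg W f]. *)
Lemma sum_inv_mul_eq0 (R : realFieldType) (p n : nat) (W : 'M['F_p]_n)
  (G u : 'rV['F_p]_n -> R) :
  (forall m w, w \in subsp W -> G (m + w) = G m) ->
  (forall m, \sum_(w in subsp W) u (m + w) = 0) ->
  \sum_x G x * u x = 0.
Proof.
move=> Ginv u0; apply: (mulfI (card_subsp_neq0 R W)); rewrite mulr0.
rewrite mulr_natl -sumr_const.
under eq_bigr => w _ do rewrite -(sum_shift _ w).
rewrite exchange_big /= big1 // => x _.
rewrite (eq_bigr (fun w => G x * u (x + w))) => [|w wW]; last by rewrite Ginv.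
by rewrite -mulr_sumr u0 mulr0.
Qed.

(** On [[0, 1]] one has [|x - y| <= x (1 - y) + y (1 - x)]. With [x = f m] and [y = F m],
    orthogonality allows [f] to be replaced by [F] in the sum of the right side. *)
Lemma sum_norm_sub_favg_le (R : realType) (p n : nat) (W : 'M['F_p]_n)
  (f : 'rV['F_p]_n -> R) :
  (forall m, 0 <= f m <= 1) ->
  \sum_x `|f x - favg W f x| <= 2 * \sum_x favg W f x * (1 - favg W f x).
Proof.
move=> f01; set F := favg W f.
have le x y : 0 <= x <= 1 -> 0 <= y <= 1 -> `|x - y| <= x + y - 2 * (x * y) :> R.
  by move=> /andP[? ?] /andP[? ?]; rewrite ler_norml; apply/andP; split; nra.
apply: (@le_trans _ _ (\sum_x (f x + F x - 2 * (f x * F x)))).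
  by apply: ler_sum => x _; apply: le => //; apply: favg_itv.
have ortho G : (forall m w, w \in subsp W -> G (m + w) = G m) ->
    \sum_x G x * (f x - F x) = 0.
  by move=> Ginv; apply: (sum_inv_mul_eq0 Ginv (@favg_sum _ _ _ W f)).
have su := ortho _ (fun m w _ => erefl (1 : R)).
have sFu := ortho F (fun m w => @favg_inv _ _ _ _ _ m w).
rewrite le_eqVlt; apply/orP; left; apply/eqP.
transitivity (\sum_x (2 * (F x * (1 - F x)) + 1 * (f x - F x)
    - 2 * (F x * (f x - F x)))).
  by apply: eq_bigr => x _; ring.
by rewrite sumrB big_split /= su addr0 -!mulr_sumr sFu mulr0 subr0.
Qed.

(** Translation by multiples of [w] carries any fibre of [dot b] onto any other, so all fibre sums
    of [G] agree. *)
Lemma radon_inv (R : realFieldType) (F : finFieldType) n (G : 'rV[F]_n -> R) b w s :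
  dot b w = 1 -> (forall m a, G (m + a *: w) = G m) ->
  #|F|%:R * radon G b s = \sum_x G x.
Proof.
move=> bw Ginv; transitivity (\sum_r radon G b r).
  rewrite mulr_natl -sumr_const; apply: eq_bigr => r _.
  rewrite /radon (reindex_inj (addIr ((s - r) *: w))) /=; apply: eq_big => x.
    rewrite dotDr dotZr bw mulr1; apply/eqP/eqP => [e|->]; last by rewrite addrC subrK.
    by rewrite -[LHS](addrK (s - r)) e opprB addrC subrK.
  by rewrite Ginv.
under eq_bigr => r _ do rewrite -[radon G b r]mul1r.
by rewrite sum_radon; apply: eq_bigr => x _; rewrite mul1r.
Qed.

(** [W] annihilates the set [A] of large frequencies of [f - mu]. By Parseval [A] has at most
    [(p - 1) / delta^2] elements, and it costs [W] only one dimension per [p - 1] of them. *)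
Lemma exists_regular_subspace (R : realType) (p n : nat) (f : 'rV['F_p]_n -> R)
  (delta : R) :
  prime p -> odd p -> 0 < delta -> (forall m, 0 <= f m <= 1) ->
  exists W : 'M['F_p]_n, (codim W)%:R <= delta ^- 2 /\
    let u := fun m => f m - favg W f m in
    `|T3 u u u| <= delta * p%:R ^+ n * \sum_x u x ^+ 2.
Proof.
move=> pp op d0 f01.
have qE : #|'F_p| = p by rewrite card_Fp.
have p1 : 1 < p%:R :> R by rewrite ltr1n prime_gt1.
have p0 : 0 < p%:R :> R by rewrite (lt_trans ltr01).
have pn0 : 0 < p%:R ^+ n :> R by rewrite exprn_gt0.
have card_rV : #|{: 'rV['F_p]_n}|%:R = p%:R ^+ n :> R.
  by rewrite card_mx mul1n card_Fp // natrX.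
pose mu := (\sum_x f x) / p%:R ^+ n.
pose f0 x := f x - mu.
pose cmu (x : 'rV['F_p]_n) := mu.
have s_mu : \sum_x cmu x = \sum_x f x.
  by rewrite sumr_const -[LHS]mulr_natr card_rV divfK ?gt_eqF.
have s0 : \sum_x f0 x = 0 by rewrite sumrB s_mu subrr.
have mu01 : 0 <= mu <= 1.
  have S0 : 0 <= \sum_x f x by apply: sumr_ge0 => x _; have /andP[] := f01 x.
  rewrite /mu divr_ge0 ?(ltW pn0) //=.
  rewrite ler_pdivrMr // mul1r -card_rV -sumr_const ler_sum // => x _.
  by have /andP[] := f01 x.
have f02 : \sum_x f0 x ^+ 2 <= p%:R ^+ n.
  rewrite -card_rV -sumr_const ler_sum // => x _.
  rewrite -[leLHS]real_normK ?num_real // expr_le1 //.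
  exact: norm_sub_le1.
pose D := delta * p%:R ^+ n.
pose A := [set b | D ^+ 2 < p%:R * radon_energy f0 b].
have [|W [WA rW]] := @exists_annihilator _ _ A.
  by move=> c b c0; rewrite !inE radon_energyZ.
have Ale : #|A|%:R * delta ^+ 2 <= p%:R - 1.
  have : \sum_(b in A) D ^+ 2 <= \sum_b p%:R * radon_energy f0 b.
    rewrite big_mkcond /=; apply: ler_sum => b _; rewrite inE.
    by case: ifP => [/ltW //|_]; rewrite mulr_ge0 ?radon_energy_ge0 ?ltW.
  have := radon_parseval s0; rewrite qE => pars.
  rewrite sumr_const -mulr_sumr pars -[leLHS]mulr_natl /D => le.
  have c0 : 0 <= (p%:R - 1) * p%:R ^+ n :> R.
    by rewrite mulr_ge0 ?(ltW pn0) // subr_ge0 ltW.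
  have {}le := le_trans le (ler_wpM2l c0 f02).
  by rewrite -(ler_pM2r (exprn_gt0 2 pn0)) -mulrA -exprMn expr2 [leRHS]mulrA.
exists W; split.
  rewrite -[leRHS]mul1r ler_pdivlMr ?exprn_gt0 //.
  have pm1 : 0 < p%:R - 1 :> R by rewrite subr_gt0.
  rewrite -(ler_pM2r pm1) mul1r mulrAC; apply: le_trans Ale.
  rewrite ler_wpM2r ?sqr_ge0 //.
  have <- : p.-1%:R = p%:R - 1 :> R by rewrite -subn1 natrB // prime_gt0.
  rewrite -natrM ler_nat; move: rW; rewrite /codim.
  by have -> : #|'F_p|.-1 = p.-1 by rewrite qE.
move=> u.
have u_avg m : \sum_(w in subsp W) u (m + w) = 0 by apply: favg_sum.
have su : \sum_x u x = 0.
  rewrite -[RHS](sum_inv_mul_eq0 (G := fun=> 1) _ u_avg) //.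
  by apply: eq_bigr => x _; rewrite mul1r.
apply: norm_T3_le_energy => //.
- exact: Fp_double_inj.
- by rewrite mulr_ge0 ?ltW.
move=> b; rewrite qE -/D.
(* If [b] is orthogonal to [W], the fibres of [dot b] are unions of cosets, where [u] sums to zero.
   If not, [b] lies outside [A], and [favg W f] and the constant [mu] have the same flat Radon
   transform, so [u] inherits the small energy of [f0]. *)
have [/existsP[w /andP[wW bw]]|/existsPn perp] :=
    boolP [exists w, (w \in subsp W) && (dot b w != 0)]; last first.
  suff -> : radon_energy u b = 0 by rewrite mulr0 sqr_ge0.
  rewrite /radon_energy big1 // => s _.
  rewrite (_ : radon u b s = 0) ?expr0n //.
  rewrite -[RHS](sum_inv_mul_eq0 (G := fun x => (dot b x == s)%:R) _ u_avg).
    rewrite /radon big_mkcond; apply: eq_bigr => x _.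
    by case: eqP; rewrite ?mul1r ?mul0r.
  move=> m v vW; rewrite dotDr; have := perp v; rewrite vW /= negbK => /eqP ->.
  by rewrite addr0.
have bA : b \notin A.
  by apply/negP => bA; rewrite (WA b w) ?eqxx // in bw; rewrite inE in wW.
have -> : radon_energy u b = radon_energy f0 b.
  rewrite /radon_energy; apply: eq_bigr => s _; congr (_ ^+ 2).
  rewrite /radon !sumrB; congr (_ - _).
  have bw1 : dot b ((dot b w)^-1 *: w) = 1 by rewrite dotZr mulVf.
  have p0' : #|'F_p|%:R != 0 :> R by rewrite qE gt_eqF.
  apply: (mulfI p0'); rewrite -!/(radon _ b s) (radon_inv _ bw1); last first.
    by move=> m a; rewrite favg_inv // !subsp_scale.
  rewrite (radon_inv (G := cmu) _ bw1) // s_mu.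
  by apply/eqP; rewrite eq_sym -subr_eq0 -sumrB su.
by move: bA; rewrite inE -leNgt.
Qed.

(** * The perturbation and its gain *)

(** Shifting [m] by [s *: w] and [d] by [e *: w] leaves [T] unchanged and adds [s] and [e] to
    [dot l m] and [dot l d]; the sum over all pairs [(s, e)] thus splits off a full
    [T3 phi phi phi]. *)
Lemma T3_lift (R : realFieldType) (p n : nat) (T : 'rV['F_p]_n -> R)
  (phi : 'F_p -> R) (l w : 'rV['F_p]_n) (a : R) (h : 'rV['F_p]_n -> R) :
  prime p -> dot l w = 1 -> (forall m s, T (m + s *: w) = T m) ->
  (forall m, h m = a * T m * phi (dot l m)) ->
  p%:R ^+ 2 * T3 h h h = a ^+ 3 * T3 T T T * T3 phi phi phi.
Proof.
move=> pp lw Tinv hE.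
have lE m s : dot l (m + s *: w) = dot l m + s by rewrite dotDr dotZr lw mulr1.
have -> : p%:R ^+ 2 * T3 h h h = \sum_(s : 'F_p) \sum_(e : 'F_p) T3 h h h.
  by rewrite !sumr_const card_Fp // -mulrnA -[RHS]mulr_natl natrM expr2.
under eq_bigr => s _ do under eq_bigr => e _ do
  rewrite (T3_shift h h h (s *: w) (e *: w)).
move P_def : (T3 phi phi phi) => P.
under eq_bigr => s _ do rewrite exchange_big /=.
rewrite exchange_big /= [T3 T T T]/T3 mulr_sumr mulr_suml; apply: eq_bigr => m _.
under eq_bigr => s _ do rewrite exchange_big /=.
rewrite exchange_big /= mulr_sumr mulr_suml; apply: eq_bigr => d _.
rewrite -P_def (T3_shift phi phi phi (dot l m) (dot l d)) mulr_sumr.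
apply: eq_bigr => s _; rewrite mulr_sumr; apply: eq_bigr => e _.
rewrite !scalerMnl -!scalerDl !hE !Tinv !lE (dotDr l m (d *+ 2)) dotMnr (dotDr l m d).
rewrite [s + dot l m]addrC [s + e + _]addrC [s + e *+ 2 + _]addrC.
by ring.
Qed.

Lemma pow_le_expR (R : realType) (p : nat) (x : R) (k : nat) : (0 < p)%N ->
  k%:R <= x -> p%:R ^+ k <= expR (x * ln p%:R).
Proof.
move=> p0 kx; have p1 : 1 <= p%:R :> R by rewrite ler1n.
rewrite -[X in X ^+ k](lnK (x := p%:R)); last by rewrite posrE ltr0n.
by rewrite -expRM_natl ler_expR ler_wpM2r ?ln_ge0.
Qed.

(** The dimension is [k + 1], with [k] the integer part of [2 c / eps]: then
    [c / (k + 1) < eps / 2], and half of the density survives in [meshulam_T3_ge]. Rounding up costs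
    the factor [p ^ 2]. *)
Lemma meshulam_T3_gt (R : realType) (p : nat) (c eps : R) (n : nat)
  (T : {set 'rV['F_p]_n}) (t : 'rV['F_p]_n -> R) :
  prime p -> 0 < c -> meshulam p c -> 0 < eps ->
  (forall x, t x = (x \in T)%:R) -> eps * p%:R ^+ n < \sum_x t x ->
  (p%:R ^+ n) ^+ 2 * expR (- (16 * eps^-1 * c * ln p%:R)) / p%:R ^+ 2 * (eps / 2)
    < T3 t t t.
Proof.
move=> pp c0 mesh e0 tE Tdens.
have p0 : 0 < p%:R :> R by rewrite ltr0n prime_gt0.
have p20 : 0 < p%:R ^+ 2 :> R by rewrite exprn_gt0.
pose k := Num.truncn (2 * c / eps).
have x0 : 0 <= 2 * c / eps by rewrite divr_ge0 ?mulr_ge0 ?ltW.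
have /andP[k1 k2] := truncn_itv x0.
have ck : c / k.+1%:R < eps / 2.
  rewrite ltr_pdivrMr ?ltr0n // mulrAC ltr_pdivlMr // mulrC.
  by rewrite [ltRHS]mulrC -ltr_pdivrMr.
have var := meshulam_T3_ge pp c0 mesh (ltn0Sn k) tE.
set E := expR _; have E0 : 0 < E by apply: expR_gt0.
(* Already [2 k <= 4 c / eps], so the constant 16 leaves room. *)
have pE : p%:R ^+ (2 * k) * E <= 1.
  have k3 : (2 * k)%:R <= 16 * eps^-1 * c.
    rewrite natrM; apply: (@le_trans _ _ (2 * (2 * c / eps))).
      by rewrite ler_wpM2l.
    have : 0 <= c / eps by rewrite divr_ge0 ?ltW.
    by clear; lra.
  have := pow_le_expR (prime_gt0 pp) k3.
  by rewrite -(ler_pM2r E0) -expRD subrr expR0.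
set N : R := p%:R ^+ n in Tdens var *.
have N0 : 0 < N by rewrite exprn_gt0.
have lt1 : N * (N * (eps / 2)) < p%:R ^+ (2 * k.+1) * T3 t t t.
  apply: lt_le_trans var; rewrite ltr_pM2l // ltrBrDr; apply: le_lt_trans Tdens.
  have : c / k.+1%:R * N < eps / 2 * N by rewrite ltr_pM2r.
  by move: (c / _); clear => r; lra.
have lt2 : N * (N * (eps / 2)) * E < p%:R ^+ (2 * k.+1) * T3 t t t * E.
  by rewrite ltr_pM2r.
have T0 : 0 <= T3 t t t.
  by apply: sumr_ge0 => x _; apply: sumr_ge0 => d _; rewrite !tE !mulr_ge0 ?ler0n.
have le3 := ler_wpM2r (mulr_ge0 (ltW p20) T0) pE.
rewrite mulrAC ltr_pdivrMr // [ltRHS]mulrC.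
move: lt2 le3; rewrite mulnS exprD.
by move: (p%:R ^+ 2) (p%:R ^+ (2 * k)); clear => A B; lra.
Qed.

(** The factor 2 pays for the error [T3 u u u] and for the required drop. The constants fit because
    [4^3 * 128 = 8192], and [eps^2 <= 1/4] absorbs what is left. *)
Lemma perturbation_gain (R : realFieldType) (eps X A : R) :
  0 < eps -> eps < 1 / 2 -> 0 < X -> X * (eps / 2) < A ->
  2 * (eps ^+ 6 * X / 8192) < (eps / 4) ^+ 3 * A / 128.
Proof.
move=> e0 e2 X0 XA.
have s1 : eps ^+ 3 * (X * (eps / 2)) < eps ^+ 3 * A by rewrite ltr_pM2l ?exprn_gt0.
have e4 : eps ^+ 2 <= 1 / 4 by nra.
have s2 : eps ^+ 4 * X * eps ^+ 2 <= eps ^+ 4 * X * (1 / 4).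
  by rewrite ler_wpM2l // mulr_ge0 ?exprn_ge0 ?ltW.
by clear -s1 s2; lra.
Qed.

(** Since [x (1 - x)] is at most [x] and at most [1 - x], the point [x] is at distance at least
    [eps / 4] from both ends. *)
Lemma perturbation_itv (R : realFieldType) (eps x y : R) :
  0 < eps -> 0 <= x <= 1 -> eps / 4 <= x * (1 - x) -> `|y| <= 1 ->
  0 <= x + - (eps / 4) * y <= 1.
Proof.
move=> e0 /andP[x0 x1] ex; rewrite ler_norml => /andP[y0 y1].
by apply/andP; split; nra.
Qed.

Theorem theorem3 (R : realType) (p : nat) (c eps : R) (n : nat)
  (f : 'rV['F_p]_n -> R) :
  prime p -> odd p ->
  0 < c -> meshulam p c ->
  0 < eps ->
  let Delta : R := eps ^+ 6 / (2 ^+ 13 * p%:R ^+ 2) *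
                   expR (- (16 * eps^-1 * c * ln p%:R)) in
  (forall m, 0 <= f m <= 1) ->
  (forall W : 'M['F_p]_n, (codim W)%:R <= Delta ^- 2 ->
     eps < Ex (fun m => `|f m - favg W f m|)) ->
  exists g : 'rV['F_p]_n -> R,
    [/\ forall m, 0 <= g m <= 1,
        Ex g = Ex f &
        Lambda3 g < Lambda3 f - Delta].
Proof.
move=> pp op c0 mesh e0 Delta f01 far.
have p1 : 1 < p%:R :> R by rewrite ltr1n prime_gt1.
have p0 : 0 < p%:R :> R by rewrite (lt_trans ltr01).
have p20 : 0 < p%:R ^+ 2 :> R by rewrite exprn_gt0.
have Delta0 : 0 < Delta.
  by rewrite /Delta mulr_gt0 ?expR_gt0 // divr_gt0 ?exprn_gt0 // mulr_gt0 ?exprn_gt0.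
pose N : R := p%:R ^+ n.
have N0 : 0 < N by rewrite exprn_gt0.
have card_rV : #|{: 'rV['F_p]_n}|%:R = N.
  by rewrite card_mx mul1n card_Fp // natrX.
have sum_cst (a : R) : \sum_(x : 'rV['F_p]_n) a = N * a.
  by rewrite sumr_const -[LHS]mulr_natl card_rV.
have [W [cW]] := exists_regular_subspace pp op Delta0 f01.
rewrite -/N; set u := fun m => _ => Tu.
have {far cW} := far W cW; set F := favg W f in u Tu *.
have F01 m : 0 <= F m <= 1 by apply: favg_itv.
have Finv m w : w \in subsp W -> F (m + w) = F m by apply: favg_inv.
have u_avg m : \sum_(w in subsp W) u (m + w) = 0 by apply: favg_sum.
have u2_avg m : \sum_(w in subsp W) u (m + w *+ 2) = 0.
  rewrite (sum_double _ _ op) // => [x|w k wW].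
    by rewrite -scaler_nat pchar_Fp_0 // scale0r.
  by rewrite -scaler_nat subsp_scale.
have fE m : f m = F m + u m by rewrite /u addrC subrK.
have su : \sum_x u x = 0.
  rewrite -[RHS](sum_inv_mul_eq0 (G := fun=> 1) _ u_avg) //.
  by apply: eq_bigr => x _; rewrite mul1r.
rewrite /Ex -/N mulrC ltr_pdivlMr // => far.
(* If [W] were zero, [f] would equal [F], against [far]. *)
have [w wW w0] : exists2 w, w \in subsp W & w != 0.
  apply/exists_inP; apply: contraT; rewrite negb_exists_in => /forall_inP W0.
  move: far; rewrite big1 => [|x _]; first by rewrite ltNge mulr_ge0 // ltW.
  have := u_avg x; rewrite (bigD1 0) ?inE ?sub0mx //= addr0 big1 ?addr0.
    by rewrite /u => ->; rewrite normr0.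
  by move=> w /andP[/W0]; case: eqP.
have {}far : eps * N < 2 * \sum_x F x * (1 - F x).
  exact: lt_le_trans far (sum_norm_sub_favg_le W f01).
pose T := [set x | eps / 4 <= F x * (1 - F x)].
pose t x : R := (x \in T)%:R.
have FF x : F x * (1 - F x) <= 1 / 4 by have := sqr_ge0 (F x - 1 / 2); clear; lra.
have e2 : eps < 1 / 2.
  have : \sum_x F x * (1 - F x) <= N * (1 / 4) by rewrite -sum_cst ler_sum.
  rewrite -(ltr_pM2r N0); move: far; set S := \sum_x _.
  by clear; lra.
(* The mean of [F (1 - F)] exceeds [eps / 2], while its values are below [eps / 4] outside [T] and
   at most [1/4] on [T]. *)
have Tdens : eps * N < \sum_x t x.
  have : \sum_x F x * (1 - F x) <= \sum_x (eps / 4 + t x / 4).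
    apply: ler_sum => x _; have := FF x; rewrite /t inE.
    by move: e0; case: (leP (eps / 4)) => /=; clear; lra.
  by rewrite big_split /= sum_cst -mulr_suml; clear -far; lra.
have [l lw] : exists l, dot l w = 1.
  by have [l wl] := dot_eq1 w0; exists l; rewrite dotC.
have [phi [phi1 sphi Tphi]] := exists_balanced_T3_ge R pp op.
(* The minus sign survives cubing in [T3_lift], and the size [eps / 4] is the room that [F] has on
   [T]. *)
pose h m : R := - (eps / 4) * t m * phi (dot l m).
have Tinv m v : v \in subsp W -> t (m + v) = t m.
  by move=> vW; rewrite /t !inE Finv.
(* Translating by [s *: w] inside [W] adds [s] to the argument of [phi]; the sum over all [s] is
   then the total of [phi], which is zero. *)
have h_avg m : \sum_(v in subsp W) h (m + v) = 0.
  rewrite (eq_bigr (fun v => - (eps / 4) * t m * phi (dot l (m + v)))); last first.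
    by move=> v vW; rewrite /h Tinv.
  rewrite -mulr_sumr; set S := \sum_(v in _) _.
  suff -> : S = 0 by rewrite mulr0.
  have p0' : #|'F_p|%:R != 0 :> R by rewrite card_Fp // gt_eqF.
  apply: (mulfI p0'); rewrite mulr0 mulr_natl -sumr_const.
  rewrite (eq_bigr (fun s => \sum_(v in subsp W) phi (dot l (m + v) + s))).
    rewrite exchange_big /= big1 // => v _.
    by rewrite -[RHS]sphi [RHS](reindex_inj (addrI (dot l (m + v)))).
  move=> s _; rewrite /S.
  rewrite -(subsp_shift (fun v => phi (dot l (m + v))) (subsp_scale s wW)).
  by apply: eq_bigr => v _; rewrite addrA [in LHS]dotDr dotZr lw mulr1.
have h2_avg m : \sum_(v in subsp W) h (m + v *+ 2) = 0.
  rewrite (sum_double _ _ op) // => [x|v k vW].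
    by rewrite -scaler_nat pchar_Fp_0 // scale0r.
  by rewrite -scaler_nat subsp_scale.
have sh : \sum_x h x = 0.
  rewrite -[RHS](sum_inv_mul_eq0 (G := fun=> 1) _ h_avg) //.
  by apply: eq_bigr => x _; rewrite mul1r.
have t01 x : 0 <= t x <= 1 by rewrite /t; case: (_ \in _); rewrite ?lexx ler01.
have W0 := card_subsp_gt0 W.
have T3f := T3_add W0 Finv u_avg u2_avg fE.
pose g m := F m + h m.
have T3g := T3_add W0 Finv h_avg h2_avg (fun m => erefl (g m)).
exists g; split.
- move=> m; rewrite /g /h /t inE; case: (leP (eps / 4)) => [Tm|_] /=; last first.
    by rewrite mulr0 mul0r addr0.
  by rewrite mulr1; apply: perturbation_itv.
- by rewrite /Ex /g big_split /= sh addr0 (eq_bigr _ (fun x _ => fE x))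
    big_split /= su addr0.
have T3h : p%:R ^+ 2 * T3 h h h = - (eps / 4) ^+ 3 * T3 t t t * T3 phi phi phi.
  rewrite (@T3_lift _ _ _ t phi l w (- (eps / 4))) //.
    by rewrite exprNn; ring.
  by move=> m s; rewrite Tinv // subsp_scale.
have Tt0 : 0 <= T3 t t t.
  apply: sumr_ge0 => x _; apply: sumr_ge0 => d _.
  by have /andP[? _] := t01 x; have /andP[? _] := t01 (x + d);
    have /andP[? _] := t01 (x + d *+ 2); rewrite !mulr_ge0.
have T3h_le : T3 h h h <= - ((eps / 4) ^+ 3 * T3 t t t / 128).
  rewrite -(ler_pM2l p20) T3h mulrN !mulNr lerN2.
  have A0 : 0 <= (eps / 4) ^+ 3 * T3 t t t.
    by rewrite mulr_ge0 // exprn_ge0 // divr_ge0 // ltW.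
  by have := ler_wpM2l A0 Tphi; clear; lra.
have Tbig := meshulam_T3_gt pp c0 mesh e0 (fun x => erefl (t x)) Tdens.
set X : R := _ / p%:R ^+ 2 in Tbig.
have X0 : 0 < X by rewrite divr_gt0 // mulr_gt0 ?expR_gt0 ?exprn_gt0.
have DX : Delta * N ^+ 2 = eps ^+ 6 * X / 8192.
  by rewrite /Delta /X -/N; field; rewrite gt_eqF.
have T3u_le : `|T3 u u u| <= Delta * N ^+ 2.
  apply: le_trans Tu _; rewrite expr2 mulrA ler_wpM2l //.
    by rewrite mulr_ge0 ?ltW.
  rewrite -[leRHS]mulr1 -sum_cst ler_sum // => x _.
  rewrite -[leLHS]real_normK ?num_real // expr_le1 //.
  exact: norm_sub_le1.
have L3E (a : 'rV['F_p]_n -> R) : Lambda3 a = T3 a a a / N ^+ 2.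
  by rewrite /Lambda3 mulrC.
have N20 : 0 < N ^+ 2 by rewrite exprn_gt0.
(* [T3 F F F] cancels; what remains is [T3 h h h < T3 u u u - Delta * N ^+ 2]. *)
rewrite !L3E ltr_pdivrMr // mulrBl divfK ?gt_eqF // T3g T3f -addrA ltrD2l.
apply: le_lt_trans T3h_le _; rewrite ltrBrDr addrC -ltrBrDr.
have u_ge : - (Delta * N ^+ 2) <= T3 u u u.
  by move: T3u_le; rewrite ler_norml => /andP[].
have := perturbation_gain e0 e2 X0 Tbig.
by move: u_ge; rewrite DX; clear; lra.
Qed.
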